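(* Let $\mathbf E$ be a conditional Banach space and let $\mathbf F$ be a conditionally normed space. Suppose that $\mathbf S$ is a conditional subset of $\mathbf L(\mathbf E,\mathbf F)$ on $1$ such that for every $\mathbf x\in\mathbf E$ there exists $\mathbf r(\mathbf x)\in\mathbf R$ with $\|\mathbf T(\mathbf x)\|\le\mathbf r(\mathbf x)$ for all $\mathbf T\in\mathbf S$. Then there exists $\mathbf s\in\mathbf R^{++}$ such that $\|\mathbf T\|\le\mathbf s$ for all $\mathbf T\in\mathbf S$.
   Context: Throughout, $\mathcal A$ is a fixed complete Boolean algebra with operations $\vee,\wedge,{}^c$ and bounds $0,1$; $p(a)$ is the set of families $\{a_i\}_{i\in I}$ of pairwise disjoint elements of $\mathcal A$ (some possibly $0$) with supremum $a$. Conditional sets. A conditional set $\mathbf E$ of a nonempty set $E$ is a collection of objects $x|a$ ($x\in E$, $a\in\mathcal A$) such that: $x|a=y|b$ implies $a=b$; if $a\le b$ and $x|b=y|b$ then $x|a=y|a$; for all $\{a_i\}\in p(1)$ and $\{x_i\}\subset E$ there is a unique $x\in E$, denoted $\sum x_i|a_i$, with $x|a_i=x_i|a_i$ for all $i$. The conditional elements of $\mathbf E$ are the objects $\mathbf x=x|1$, $x\in E$; write $\mathbf x\in\mathbf E$. A nonempty $F\subset E$ is stable if it contains all $\sum x_i|a_i$ with $\{a_i\}\in p(1)$, $\{x_i\}\subset F$; the stable hull of a nonempty set is the smallest stable set containing it. For $F$ stable and $a\in\mathcal A$, $\mathbf F|a=\{x|b: x\in F,\ b\le a\}$ is called a conditional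 subset of $\mathbf E$ on $a$ (and $\mathbf F=\mathbf F|1$); its conditional elements are the $x|a$ with $x\in F$. $[\mathbf x\in\mathbf E:\phi(\mathbf x)]$ is the conditional subset on $1$ generated by the stable hull of the (nonempty) set $\{x:\phi(\mathbf x)\}$. Functions. A function $f:E\to F$ is stable if $f(\sum x_i|a_i)=\sum f(x_i)|a_i$; it then defines a conditional function $\mathbf f:\mathbf E\to\mathbf F$, $\mathbf f(\mathbf x)=f(x)|1$. $\mathbf E\Join\mathbf F$ is the conditional set of $E\times F$ with $(x,y)|a=(x|a,y|a)$. A conditional sequence $\{\mathbf x_{\mathbf n}\}_{\mathbf n\in\mathbf N}$ in $\mathbf E$ is a conditional function $\mathbf n\mapsto\mathbf x_{\mathbf n}$ from $\mathbf N$ to $\mathbf E$. Numbers. $\mathbf N$ (resp. $\mathbf Q$) is the conditional set whose generating set $N$ (resp. $Q$) consists of formal sums $\sum n_i|a_i$ with $\{a_i\}\in p(1)$ and $n_i\in\mathbb N=\{1,2,\dots\}$ (resp. $n_i\in\mathbb Q$), where $(\sum n_i|a_i)|a=(\sum m_j|b_j)|a$ iff $n_i=m_j$ whenever $a_i\wedge b_j\wedge a\ne0$; operations and order are componentwise ($\sum n_i|a_i\le\sum m_j|b_j$ iff $n_i\le m_j$ whenever $a_i\wedge b_j\ne0$; similarly $<$). $\mathbf R$ denotes the conditional real numbers: the conditionally totally ordered, conditionally Dedekind complete field containing $\mathbf Q$ (extending its operations and order). That is, $\mathbf R$ is a conditional set of a set $R$ with stable commutative ring operations such that every $r$ with $r|a\neq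 0|a$ for all $a\ne0$ is invertible, and with a stable partial order compatible with the ring operations such that for all $r,s$ there is $a$ with $r|a\le s|a$ and $s|a^c\le r|a^c$ (where $r|a\le s|a$ means $r|a+s|a^c\le s$), and every conditional subset on $1$ with an upper bound has a supremum. It is unique up to isomorphism; for the measure algebra of a $\sigma$-finite measure space $R=L^0$. $\mathbf r<\mathbf s$ means $\mathbf r\le\mathbf s$ and $r|a\ne s|a$ for all $a\neq0$. $\mathbf R^+=[\mathbf r\ge\mathbf 0]$, $\mathbf R^{++}=[\mathbf r>\mathbf 0]$, and $|\mathbf r|$ is the supremum of $\mathbf r,-\mathbf r$. Normed spaces. A conditional vector space is a conditional set $\mathbf E$ with stable operations $+:\mathbf E\Join\mathbf E\to\mathbf E$, $\cdot:\mathbf R\Join\mathbf E\to\mathbf E$ making $E$ a unital $R$-module. Every conditional vector space is assumed to have support $1$: $\bigvee\{a:\exists x\in E,\ x|b\neq0|b\ \forall\,0\ne b\le a\}=1$. A conditionally normed space is a conditional vector space with a conditional function $\|\cdot\|:\mathbf E\to\mathbf R^+$ with $\|\mathbf r\mathbf x\|=|\mathbf r|\|\mathbf x\|$, $\|\mathbf x+\mathbf y\|\le\|\mathbf x\|+\|\mathbf y\|$, and $\|\mathbf x\|=\mathbf 0$ only if $\mathbf x=\mathbf 0$. $\mathbf E$ is a conditional Banach space if every conditional sequence $\{\mathbf x_{\mathbf n}\}$ that is conditionally Cauchy (for each $\mathbf r\in\mathbf R^{++}$ there is $\mathbf n\in\mathbf N$ with $\|\mathbf x_{\mathbf p}-\mathbf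 x_{\mathbf q}\|\le\mathbf r$ for all $\mathbf p,\mathbf q>\mathbf n$) conditionally converges (there is $\mathbf x$ such that for each $\mathbf r\in\mathbf R^{++}$ there is $\mathbf m$ with $\|\mathbf x_{\mathbf n}-\mathbf x\|\le\mathbf r$ for all $\mathbf n\ge\mathbf m$). $\mathbf L(\mathbf E,\mathbf F)$ is the conditional vector space of conditional functions $\mathbf T:\mathbf E\to\mathbf F$ that are conditionally linear ($T$ is $R$-linear) and conditionally continuous (equivalently, $\|\mathbf T(\mathbf x)\|\le\mathbf r\|\mathbf x\|$ for all $\mathbf x$ for some $\mathbf r\in\mathbf R$), with $T|a=S|a$ iff $T(x)|a=S(x)|a$ for all $x$; its norm is $\|\mathbf T\|=\sup[\|\mathbf T(\mathbf x)\|:\|\mathbf x\|\le\mathbf 1]$. *)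

(* Defs.v *)
From HB Require Import structures.
From mathcomp Require Import all_boot all_order all_algebra.
From mathcomp Require Import boolp classical_sets.

Set Implicit Arguments.
Unset Strict Implicit.
Unset Printing Implicit Defensive.

Import Order.TTheory Order.CTheory GRing.Theory.

Local Open Scope classical_set_scope.
Local Open Scope order_scope.

HB.mixin Record hasSupremums d A of Order.CTBDistrLattice d A := {
  supremums_ex : forall B : set A, supremums B !=set0
}.

#[short(type="completeBAType")]
HB.structure Definition CompleteBA d :=
  {A of Order.CTBDistrLattice d A & hasSupremums d A}.

Section Partition.
Context {d : Order.disp_t} {A : completeBAType d}.
Implicit Types (a b c : A) (B : set A).

(* The families of p(a); members may be \bot. *)
Definition is_partition (a : A) (I : Type) (f : I -> A) : Prop :=
  (forall i j, i <> j -> (f i `&` f j)%O = \bot) /\ supremums (range f) a.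

Lemma supremumP B : supremums B (supremum \bot B).
Proof.
rewrite /supremum; case: ifPn => [/eqP ->|_].
  by split=> // x _; exact: le0x.
by case: xgetP => // h; case: (supremums_ex B) => s /h.
Qed.

Lemma supremums_meet B a s :
  supremums B s -> supremums [set (a `&` b)%O | b in B] (a `&` s)%O.
Proof.
move=> [ubs lbs]; split=> [_ [b Bb <-]|u ubu]; first by rewrite leI2 // ubs.
suff /lbs : ubound B (u `|` ~` a)%O.
  by rewrite joinC -leBLR diffE complK meetC.
move=> b Bb; have /ubu h : [set (a `&` b)%O | b in B] (a `&` b)%O by exists b.
by rewrite joinC -leBLR diffE complK meetC.
Qed.

Lemma partition_meet_neq0 I (f : I -> A) a :
  is_partition \top f -> a != \bot -> exists i, (a `&` f i)%O != \bot.
Proof.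
move=> [_ sf] a0; apply: contrapT => h; move: a0 => /eqP; apply.
have [_ lb] := supremums_meet a sf.
apply/eqP; rewrite -lex0 -[leLHS]meetx1; apply: lb => _ [_ [i _ <-] <-].
by rewrite lex0; apply/negPn/negP => hi; apply: h; exists i.
Qed.

Lemma partition_compl a :
  is_partition \top (fun b : bool => if b then a else (~` a)%O).
Proof.
split=> [[] [] //= _|]; rewrite ?meetxC ?meetCx //.
split=> [x _|u ubu]; first exact: lex1.
rewrite -(joinxC a) leUx; apply/andP; split; apply: ubu.
  by exists true.
by exists false.
Qed.

Lemma partition_unit : is_partition (\top : A) (fun _ : unit => \top).
Proof. by split=> [[] [] //|]; split=> [x _|u]; [exact: lex1|apply; exists tt]. Qed.

Lemma partition_dep I (f : I -> A) X (g : I -> X -> A) :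
  is_partition \top f -> (forall i, is_partition \top (g i)) ->
  is_partition \top (fun p : I * X => (f p.1 `&` g p.1 p.2)%O).
Proof.
move=> [df sf] pg; split=> [[i x] [j y] /= ne|].
  rewrite meetACA; have [ij|ij] := pselect (i = j); last by rewrite df // meet0x.
  rewrite -ij (pg i).1 ?meetx0 // => xy; by apply: ne; rewrite ij xy.
split=> [x _|u ubu]; first exact: lex1.
apply: sf.2 => _ [i _ <-]; have [_ lb] := supremums_meet (f i) (pg i).2.
rewrite -[f i]meetx1; apply: lb => _ [_ [x _ <-] <-].
by apply: ubu; exists (i, x).
Qed.

End Partition.

(* restr x a is the object x | a. *)
HB.mixin Record isCondSet d (A : completeBAType d) E := {
  cobj : Type;
  restr : E -> A -> cobj;
  restr_inj : forall x y a b, restr x a = restr y b -> a = b;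
  restr_le : forall x y a b, (a <= b)%O ->
    restr x b = restr y b -> restr x a = restr y a;
  restr_glue : forall (I : Type) (a : I -> A) (x : I -> E),
    is_partition \top a ->
    exists! z, forall i, restr z (a i) = restr (x i) (a i);
  restr_inhabited : inhabited E
}.

#[short(type="condSetType")]
HB.structure Definition CondSet d A := {E of isCondSet d A E}.
Arguments cobj {d A} s.
Arguments restr {d A s} x a.
Arguments restr_le {d A s x y a b}.
Arguments restr_inj {d A s x y a b}.

Section CondSetTheory.
Context {d : Order.disp_t} {A : completeBAType d}.

(* csum pa x is the element \sum x_i | a_i *)
Definition csum {E : condSetType A} {I : Type} {a : I -> A}
  (pa : is_partition \top a) (x : I -> E) : E :=
  projT1 (cid (@restr_glue _ _ E I a x pa)).

(* x | a + y | a^c *)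
Definition cif {E : condSetType A} (a : A) (x y : E) : E :=
  csum (partition_compl a) (fun b => if b then x else y).

Definition stable_fun {E F : condSetType A} (f : E -> F) : Prop :=
  forall (I : Type) (a : I -> A) (pa : is_partition \top a) (x : I -> E),
    f (csum pa x) = csum pa (f \o x).

(* A conditional subset on 1 is determined by, and here identified with, its
   stable generating set. *)
Definition stable_set {E : condSetType A} (F : set E) : Prop :=
  F !=set0 /\
  forall (I : Type) (a : I -> A) (pa : is_partition \top a) (x : I -> E),
    (forall i, F (x i)) -> F (csum pa x).

Definition stable_hull {E : condSetType A} (F : set E) : set E :=
  smallest stable_set F.

Section Theory.
Context {E : condSetType A}.
Implicit Types (x y z : E) (a : A).

Lemma csumP I (a : I -> A) (pa : is_partition \top a) (x : I -> E) i :
  restr (csum pa x) (a i) = restr (x i) (a i).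
Proof. by rewrite /csum; case: cid => z /= [+ _]; apply. Qed.

Lemma csum_unique I (a : I -> A) (pa : is_partition \top a) (x : I -> E) z :
  (forall i, restr z (a i) = restr (x i) (a i)) -> z = csum pa x.
Proof.
move=> zx; have [w [_ wu]] := @restr_glue _ _ E I a x pa.
by rewrite -(wu z) // -(wu (csum pa x)) // => i; rewrite csumP.
Qed.

Lemma restr_eq I (a : I -> A) (pa : is_partition \top a) x y :
  (forall i, restr x (a i) = restr y (a i)) -> x = y.
Proof.
by move=> h; rewrite (csum_unique pa h); apply/esym/csum_unique.
Qed.

(* conditional elements x | 1 are in bijection with elements of E *)
Lemma restr1_inj : injective (restr^~ \top : E -> cobj E).
Proof. by move=> x y xy; exact: (restr_eq partition_unit). Qed.

Lemma cifT a x y : restr (cif a x y) a = restr x a.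
Proof. exact: (csumP (partition_compl a) (fun b => if b then x else y) true). Qed.

Lemma cifF a x y : restr (cif a x y) (~` a)%O = restr y (~` a)%O.
Proof. exact: (csumP (partition_compl a) (fun b => if b then x else y) false). Qed.

Lemma cif_unique a x y z :
  restr z a = restr x a -> restr z (~` a)%O = restr y (~` a)%O ->
  z = cif a x y.
Proof. by move=> za zb; apply: csum_unique => -[]. Qed.

Lemma cif_congr a x x' y y' : restr x a = restr x' a ->
  restr y (~` a)%O = restr y' (~` a)%O -> cif a x y = cif a x' y'.
Proof. by move=> xx yy; apply: cif_unique; rewrite ?cifT ?cifF. Qed.

Lemma cif_id a x : cif a x x = x.
Proof. by apply/esym/cif_unique. Qed.

Lemma csum_restr I (b : I -> A) (pb : is_partition \top b) (x y : I -> E) a :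
  (forall i, restr (x i) a = restr (y i) a) ->
  restr (csum pb x) a = restr (csum pb y) a.
Proof.
move=> xy; suff <- : cif a (csum pb x) (csum pb y) = csum pb y by rewrite cifT.
apply: (restr_eq (partition_dep (partition_compl a) (fun=> pb))) => -[[] i].
  transitivity (restr (csum pb x) (a `&` b i)%O).
    exact: (restr_le (leIl _ _) (cifT _ _ _)).
  rewrite (restr_le (leIr _ _) (csumP pb x i)) (restr_le (leIl _ _) (xy i)).
  by rewrite (restr_le (leIr _ _) (csumP pb y i)).
exact: (restr_le (leIl _ _) (cifF _ _ _)).
Qed.

Lemma stable_set_cif (G : set E) a x y :
  stable_set G -> G x -> G y -> G (cif a x y).
Proof. by move=> [_ sG] Gx Gy; apply: sG => -[]. Qed.

Lemma stable_hullP (G : set E) : G !=set0 -> stable_set (stable_hull G).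
Proof.
move=> [x Gx]; split; first by exists x => H [_ GH]; exact: GH.
move=> I a pa y hy H [sH GH]; apply: sH.2 => i; exact: hy.
Qed.

End Theory.

Section FunTheory.
Context {E F : condSetType A}.
Implicit Types (x y : E) (a : A).

Lemma stable_fun_cif (f : E -> F) a x y :
  stable_fun f -> f (cif a x y) = cif a (f x) (f y).
Proof.
by move=> sf; rewrite /cif sf; congr csum; apply/funext => -[].
Qed.

Lemma stable_fun_restr (f : E -> F) a x y :
  stable_fun f -> restr x a = restr y a -> restr (f x) a = restr (f y) a.
Proof.
move=> sf xy; have -> : x = cif a y x by apply: cif_unique.
by rewrite (stable_fun_cif a y x sf) cifT.
Qed.

End FunTheory.

End CondSetTheory.

Section CondProd.
Context {d : Order.disp_t} {A : completeBAType d} (E F : condSetType A).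

Let prod_restr (p : E * F) (a : A) : cobj E * cobj F :=
  (restr p.1 a, restr p.2 a).

Let prod_restr_inj p q a b : prod_restr p a = prod_restr q b -> a = b.
Proof. by move=> [/restr_inj]. Qed.

Let prod_restr_le p q a b : (a <= b)%O ->
  prod_restr p b = prod_restr q b -> prod_restr p a = prod_restr q a.
Proof.
by move=> ab [h k]; rewrite /prod_restr (restr_le ab h) (restr_le ab k).
Qed.

Let prod_glue (I : Type) (a : I -> A) (x : I -> E * F) :
  is_partition \top a ->
  exists! z, forall i, prod_restr z (a i) = prod_restr (x i) (a i).
Proof.
move=> pa; exists (csum pa (fst \o x), csum pa (snd \o x)); split=> [i|[u v] h].
  by rewrite /prod_restr /= !csumP.
by congr pair; apply/esym/csum_unique => i; case: (h i).
Qed.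

Let prod_inhabited : inhabited (E * F).
Proof.
by have [[x] [y]] := (@restr_inhabited _ _ E, @restr_inhabited _ _ F).
Qed.

HB.instance Definition _ := isCondSet.Build d A (E * F)%type
  prod_restr_inj prod_restr_le prod_glue prod_inhabited.

Lemma csum_pair I (a : I -> A) (pa : is_partition \top a) (x : I -> E * F) :
  csum pa x = (csum pa (fst \o x), csum pa (snd \o x)).
Proof.
by apply/esym/csum_unique => i; rewrite /restr /= /prod_restr /= !csumP.
Qed.

End CondProd.

(* The formal sum \sum n_i | a_i over X is represented by the partition
   x |-> \sup {a_i : n_i = x}; see cstep_formal and cstep_restrE. *)
Record cstep {d : Order.disp_t} (A : completeBAType d) (X : Type) := CStep {
  cstep_at :> X -> A;
  cstep_partition : is_partition \top cstep_at
}.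

Section CStepTheory.
Context {d : Order.disp_t} {A : completeBAType d}.

Lemma supremum_meet0 (B C : set A) :
  (forall b c, B b -> C c -> (b `&` c)%O = \bot) ->
  (supremum \bot B `&` supremum \bot C)%O = \bot.
Proof.
move=> h; apply/eqP; rewrite -lex0.
have [_ ] := supremums_meet (supremum \bot B) (supremumP C); apply.
move=> _ [c Cc <-]; rewrite meetC.
have [_ ] := supremums_meet c (supremumP B); apply.
by move=> _ [b Bb <-]; rewrite meetC h.
Qed.

Section Formal.
Context {X I : Type} {a : I -> A} (pa : is_partition \top a) (n : I -> X).

Definition formal_at (x : X) : A :=
  supremum \bot [set a i | i in [set i | n i = x]].

Lemma formal_partition : is_partition \top formal_at.
Proof.
split=> [x y xy|].
  apply: supremum_meet0 => _ _ [i ix <-] [j jy <-]; apply: pa.1 => ij.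
  by apply: xy; rewrite -ix -jy ij.
split=> [x _|u ubu]; first exact: lex1.
apply: pa.2.2 => _ [i _ <-].
apply: (@le_trans _ _ (formal_at (n i))); last by apply: ubu; exists (n i).
by apply: (supremumP _).1; exists i.
Qed.

Definition formal_sum : cstep A X := CStep formal_partition.

Lemma formal_sumE i x : (a i `&` formal_sum x)%O =
  if `[< n i = x >] then a i else \bot.
Proof.
case: asboolP => nix.
  by apply/eqP; rewrite -leEmeet; apply: (supremumP _).1; exists i.
apply/eqP; rewrite -lex0; have [_] := supremums_meet (a i)
  (supremumP [set a i | i in [set i | n i = x]]); apply.
move=> _ [_ [j jx <-] <-]; rewrite pa.1 // => ij.
by apply: nix; rewrite ij.
Qed.

End Formal.

Lemma cstep_eq X (u v : cstep A X) : (forall x, u x = v x) -> u = v.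
Proof.
case: u v => [u pu] [v pv] /= /funext uv; case: _ / uv in pv *.
by congr CStep; exact: Prop_irrelevance.
Qed.

Section Instance.
Context {X : pointedType}.
Implicit Types u v w : cstep A X.

Let step_restr u (a : A) : A * (X -> A) := (a, fun x => (a `&` u x)%O).

Let step_restr_inj u v a b : step_restr u a = step_restr v b -> a = b.
Proof. by case. Qed.

Let step_restr_le u v a b : (a <= b)%O ->
  step_restr u b = step_restr v b -> step_restr u a = step_restr v a.
Proof.
move=> /meet_idPl ab [h]; rewrite /step_restr; congr pair; apply/funext => x.
by rewrite -ab -!meetA; congr (_ `&` _)%O; exact: (congr1 (@^~ x) h).
Qed.

Let step_glue (I : Type) (a : I -> A) (u : I -> cstep A X) :
  is_partition \top a ->
  exists! z, forall i, step_restr z (a i) = step_restr (u i) (a i).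
Proof.
move=> pa; have pu i := cstep_partition (u i).
pose z := formal_sum (partition_dep pa pu) (fun p : I * X => p.2).
have zE i : step_restr z (a i) = step_restr (u i) (a i).
  rewrite /step_restr; congr pair; apply/funext => x.
  have [_ lb] := supremums_meet (a i `&` z x)%O (pu i).2.
  apply/eqP; rewrite eq_le; apply/andP; split.
    rewrite -[leLHS]meetx1; apply: lb => _ [_ [y _ <-] <-].
    have := formal_sumE (partition_dep pa pu) (fun p : I * X => p.2) (i, y) x.
    rewrite /= -/z meetAC => ->; case: asboolP => [->//|_]; exact: le0x.
  have := formal_sumE (partition_dep pa pu) (fun p : I * X => p.2) (i, x) x.
  rewrite /= -/z; case: asboolP => // _ <-.
  by rewrite lexI leIr andbT -meetA leIl.
exists z; split=> // w wE; apply: cstep_eq => x.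
have [_ lz] := supremums_meet (z x) pa.2; have [_ lw] := supremums_meet (w x) pa.2.
have e i : (z x `&` a i = w x `&` a i)%O.
  rewrite ![(_ `&` a i)%O]meetC.
  by have [h] := etrans (zE i) (esym (wE i)); exact: (congr1 (@^~ x) h).
apply/eqP; rewrite eq_le; apply/andP; split.
  by rewrite -[leLHS]meetx1; apply: lz => _ [_ [i _ <-] <-]; rewrite e leIl.
by rewrite -[leLHS]meetx1; apply: lw => _ [_ [i _ <-] <-]; rewrite -e leIl.
Qed.

HB.instance Definition _ := isCondSet.Build d A (cstep A X)
  step_restr_inj step_restr_le step_glue
  (inhabits (formal_sum partition_unit (fun=> point))).

Lemma cstep_restrP u v a :
  restr u a = restr v a <-> (forall x, a `&` u x = a `&` v x)%O.
Proof.
split=> [[h] x|h]; first exact: (congr1 (@^~ x) h).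
by congr pair; apply/funext.
Qed.

Lemma cstep_restrE u v a : restr u a = restr v a <->
  forall x y, ((u x `&` v y) `&` a)%O != \bot -> x = y.
Proof.
rewrite cstep_restrP; split=> [h x y /eqP|h x].
  apply: contra_notP => xy; rewrite meetAC [(u x `&` a)%O]meetC h -meetA.
  by rewrite (cstep_partition v).1 // meetx0.
have h' y z : y <> z -> (u y `&` v z `&` a)%O = \bot.
  by move=> yz; apply/eqP/negPn/negP => /h.
have [_ lu] := supremums_meet (a `&` u x)%O (cstep_partition v).2.
have [_ lv] := supremums_meet (a `&` v x)%O (cstep_partition u).2.
apply/eqP; rewrite eq_le; apply/andP; split.
  rewrite -[leLHS]meetx1; apply: lu => _ [_ [y _ <-] <-].
  have [->|xy] := pselect (x = y); first by rewrite leI2 // leIl.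
  by rewrite -meetA meetC h' // le0x.
rewrite -[leLHS]meetx1; apply: lv => _ [_ [y _ <-] <-].
have [->|xy] := pselect (x = y); first by rewrite leI2 // leIl.
by rewrite -meetA meetC [(v x `&` _)%O]meetC h' ?le0x// => /esym.
Qed.

End Instance.

(* every element is a formal sum *)
Lemma cstep_formal X (u : cstep A X) :
  u = formal_sum (cstep_partition u) id.
Proof.
apply: cstep_eq => x /=; rewrite /formal_at.
by rewrite (_ : [set _ | _ in _] = [set u x]) ?supremum1 //;
  apply/seteqP; split=> [_ [_ -> <-]//|_ ->]; exists x.
Qed.

Definition cstep_const X (x : X) : cstep A X :=
  formal_sum partition_unit (fun=> x).

Lemma cstep_constE X (x y : X) :
  cstep_const x y = if `[< x = y >] then \top else \bot.
Proof.
by have := formal_sumE partition_unit (fun=> x) tt y; rewrite meet1x.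
Qed.

Definition cstep_map2 X Y Z (f : X -> Y -> Z) (u : cstep A X) (v : cstep A Y) :
  cstep A Z :=
  formal_sum
    (partition_dep (cstep_partition u) (fun=> cstep_partition v))
    (fun p => f p.1 p.2).

Lemma cstep_map2_const X Y Z (f : X -> Y -> Z) x y :
  cstep_map2 f (cstep_const x) (cstep_const y) = cstep_const (f x y).
Proof.
apply: cstep_eq => z; have := formal_sumE
  (partition_dep (cstep_partition (cstep_const x))
                 (fun=> cstep_partition (cstep_const y)))
  (fun p => f p.1 p.2) (x, y) z.
cbv beta; rewrite [(x, y).1]/= [(x, y).2]/= !cstep_constE.
by rewrite (asboolT (erefl x)) (asboolT (erefl y)) !meet1x.
Qed.

Definition cstep_rel X Y (r : X -> Y -> bool) (u : cstep A X) (v : cstep A Y) :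
  Prop :=
  forall x y, (u x `&` v y)%O != \bot -> r x y.

End CStepTheory.

Definition posnat := {n : nat | (0 < n)%N}.
HB.instance Definition _ := Choice.on posnat.
HB.instance Definition _ := isPointed.Build posnat (exist _ 1%N isT).
HB.instance Definition _ := isPointed.Build rat 0%R.

Section CondNumbers.
Context {d : Order.disp_t} (A : completeBAType d).

Definition cnat := cstep A posnat.
HB.instance Definition _ := CondSet.on cnat.

Definition crat := cstep A rat.
HB.instance Definition _ := CondSet.on crat.

End CondNumbers.

Section CondNumbersOps.
Context {d : Order.disp_t} {A : completeBAType d}.

Definition cnat_le (m n : cnat A) : Prop :=
  cstep_rel (fun i j : posnat => (val i <= val j)%N) m n.
Definition cnat_lt (m n : cnat A) : Prop :=
  cstep_rel (fun i j : posnat => (val i < val j)%N) m n.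

Definition crat_const (q : rat) : crat A := cstep_const q.
Definition crat_add (p q : crat A) : crat A := cstep_map2 +%R p q.
Definition crat_mul (p q : crat A) : crat A := cstep_map2 *%R p q.
Definition crat_le (p q : crat A) : Prop := cstep_rel <=%R p q.

End CondNumbersOps.

Local Open Scope ring_scope.

HB.mixin Record isCondZmod d (A : completeBAType d) E
    of isCondSet d A E & GRing.Zmodule E := {
  caddr_stable : stable_fun (fun p : E * E => p.1 + p.2)
}.

#[short(type="condZmodType")]
HB.structure Definition CondZmod d A :=
  {E of isCondSet d A E & GRing.Zmodule E & isCondZmod d A E}.

(* The conditional order is a Prop-valued operation: MathComp has no partially
   ordered rings below numDomainType, and R is in general not a domain. *)
HB.mixin Record hasCondLe R := { cle : R -> R -> Prop }.
#[short(type="condLeType")]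
HB.structure Definition CondLe := {R of hasCondLe R}.

Declare Scope cond_scope.
Notation "x <=c y" := (cle x y) (at level 70) : cond_scope.
Local Open Scope cond_scope.

Definition cubound {R : condLeType} (S : set R) : set R :=
  [set u | forall r, S r -> r <=c u].

Definition csupremums {R : condLeType} (S : set R) : set R :=
  [set s | cubound S s /\ forall u, cubound S u -> s <=c u].

HB.mixin Record isCondReal d (A : completeBAType d) R
    of CondZmod d A R & hasCondLe R & GRing.ComPzRing R := {
  cmulr_stable : stable_fun (fun p : R * R => p.1 * p.2);
  cr_inv : forall r : R,
    (forall a : A, a <> \bot -> restr r a <> restr (0 : R) a) ->
    exists s : R, r * s = 1;
  cle_refl : forall r : R, r <=c r;
  cle_anti : forall r s : R, r <=c s -> s <=c r -> r = s;
  cle_trans : forall r s t : R, r <=c s -> s <=c t -> r <=c t;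
  cle_stable : stable_set [set p : R * R | p.1 <=c p.2];
  cle_add : forall r s t : R, r <=c s -> r + t <=c s + t;
  cle_mul : forall r s : R,
    (0 : R) <=c r -> (0 : R) <=c s -> (0 : R) <=c r * s;
  (* r | a <= s | a means cif a r s <= s *)
  cle_total : forall r s : R, exists a : A,
    cif a r s <=c s /\ cif (~` a)%O s r <=c r;
  cr_dedekind : forall S : set R,
    stable_set S -> cubound S !=set0 -> csupremums S !=set0;
  cr_rat : exists iota : crat A -> R,
    (stable_fun iota /\ injective iota) /\
    [/\ iota (crat_const 1) = 1,
        forall p q, iota (crat_add p q) = iota p + iota q,
        forall p q, iota (crat_mul p q) = iota p * iota q
      & forall p q, iota p <=c iota q <-> crat_le p q]
}.

#[short(type="condRealType")]
HB.structure Definition CondReal d A :=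
  {R of CondZmod d A R & hasCondLe R & GRing.ComPzRing R & isCondReal d A R}.
Arguments cle_trans {d A R} [r s t] : rename.
Arguments cle_anti {d A R} [r s] : rename.
Arguments cle_add {d A R} [r s] t : rename.
Arguments cle_mul {d A R} [r s] : rename.

Section CondRealDefs.
Context {d : Order.disp_t} {A : completeBAType d} {R : condRealType A}.
Implicit Types (r s : R).

Definition clt r s : Prop :=
  r <=c s /\ forall a : A, a <> \bot -> restr r a <> restr s a.

Definition cnneg : set R := stable_hull [set r : R | (0 : R) <=c r].
Definition cpos : set R := stable_hull [set r : R | clt 0 r].

(* the supremum of S, or 0 if there is none *)
Definition csup (S : set R) : R := xget 0 (csupremums S).

Definition cabs r : R := csup [set r; - r].

End CondRealDefs.
Arguments cnneg {d A} R.
Arguments cpos {d A} R.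

HB.mixin Record isCondVect d (A : completeBAType d) (R : condRealType A) E
    of CondZmod d A E & GRing.Lmodule R E := {
  cscale_stable : stable_fun (fun p : R * E => p.1 *: p.2);
  cvect_support : supremums
    [set a : A | exists x : E,
       forall b : A, b <> \bot -> (b <= a)%O -> restr x b <> restr (0 : E) b] \top
}.

#[short(type="condVectType")]
HB.structure Definition CondVect d (A : completeBAType d) (R : condRealType A) :=
  {E of CondZmod d A E & GRing.Lmodule R E & isCondVect d A R E}.

HB.mixin Record isCondNormed d (A : completeBAType d) (R : condRealType A) E
    of @CondVect d A R E := {
  cnorm : E -> R;
  cnorm_stable : stable_fun cnorm;
  cnorm_nneg : forall x, cnneg R (cnorm x);
  cnormZ : forall r x, cnorm (r *: x) = cabs r * cnorm x;
  cnormD : forall x y, cnorm (x + y) <=c cnorm x + cnorm y;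
  cnorm0_eq0 : forall x, cnorm x = 0 -> x = 0
}.

#[short(type="condNormedType")]
HB.structure Definition CondNormed d (A : completeBAType d) (R : condRealType A) :=
  {E of @CondVect d A R E & isCondNormed d A R E}.

Section CondSeq.
Context {d : Order.disp_t} {A : completeBAType d} {R : condRealType A}.
Context {E : condNormedType R}.
Implicit Types u : cnat A -> E.

Definition ccauchy u : Prop :=
  forall r : R, cpos R r -> exists n : cnat A,
    forall p q : cnat A, cnat_lt n p -> cnat_lt n q -> cnorm (u p - u q) <=c r.

Definition cconverges u (x : E) : Prop :=
  forall r : R, cpos R r -> exists m : cnat A,
    forall n : cnat A, cnat_le m n -> cnorm (u n - x) <=c r.

End CondSeq.

HB.mixin Record isCondBanach d (A : completeBAType d) (R : condRealType A) E
    of @CondNormed d A R E := {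
  cbanach_complete : forall u : cnat A -> E,
    stable_fun u -> ccauchy u -> exists x : E, cconverges u x
}.

#[short(type="condBanachType")]
HB.structure Definition CondBanach d (A : completeBAType d) (R : condRealType A) :=
  {E of @CondNormed d A R E & isCondBanach d A R E}.

Section CondZmodTheory.
Context {d : Order.disp_t} {A : completeBAType d} {E : condZmodType A}.

Lemma csumD I (a : I -> A) (pa : is_partition \top a) (x y : I -> E) :
  csum pa (fun i => x i + y i) = csum pa x + csum pa y.
Proof.
have := @caddr_stable _ _ E I a pa (fun i => (x i, y i)).
by rewrite csum_pair.
Qed.

Lemma csum_cst I (a : I -> A) (pa : is_partition \top a) (x : E) :
  csum pa (fun=> x) = x.
Proof. by apply/esym/csum_unique. Qed.

Lemma csumN I (a : I -> A) (pa : is_partition \top a) (x : I -> E) :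
  csum pa (fun i => - x i) = - csum pa x.
Proof.
apply/eqP; rewrite -subr_eq0 opprK -csumD.
by under eq_fun do rewrite addNr; rewrite csum_cst.
Qed.

End CondZmodTheory.

Section CondRealTheory.
Context {d : Order.disp_t} {A : completeBAType d} {R : condRealType A}.
Implicit Types (r s t : R) (a b : A).

Lemma csumM I (a : I -> A) (pa : is_partition \top a) (x y : I -> R) :
  csum pa (fun i => x i * y i) = csum pa x * csum pa y.
Proof.
have := @cmulr_stable _ _ R I a pa (fun i => (x i, y i)).
by rewrite csum_pair.
Qed.

Lemma csum_le I (a : I -> A) (pa : is_partition \top a) (x y : I -> R) :
  (forall i, x i <=c y i) -> csum pa x <=c csum pa y.
Proof.
move=> xy; have [_ /(_ I a pa (fun i => (x i, y i)))] := @cle_stable _ _ R.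
by rewrite csum_pair; apply.
Qed.

Lemma cif_le a r r' s s' : r <=c r' -> s <=c s' -> cif a r s <=c cif a r' s'.
Proof. by move=> ? ?; apply: csum_le => -[]. Qed.

Lemma cifM a r r' s s' : cif a r s * cif a r' s' = cif a (r * r') (s * s').
Proof. by rewrite -csumM; congr csum; apply/funext => -[]. Qed.

Lemma cle_sub0 r s : r <=c s <-> (0 : R) <=c s - r.
Proof.
split=> [/(cle_add (- r))|/(cle_add r)]; first by rewrite subrr.
by rewrite add0r subrK.
Qed.

Lemma cleD r r' s s' : r <=c r' -> s <=c s' -> r + s <=c r' + s'.
Proof.
move=> h k; apply: (cle_trans (cle_add s h)).
by rewrite ![r' + _]addrC; exact: cle_add.
Qed.

Lemma cle_pmul r s t : (0 : R) <=c t -> r <=c s -> t * r <=c t * s.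
Proof. by move=> t0 /cle_sub0 h; apply/cle_sub0; rewrite -mulrBr; exact: cle_mul. Qed.

Lemma cle_pmulr r s t : (0 : R) <=c t -> r <=c s -> r * t <=c s * t.
Proof. by move=> t0 h; rewrite ![_ * t]mulrC; exact: cle_pmul. Qed.

Lemma cif_compl a r s : cif (~` a)%O r s = cif a s r.
Proof.
apply: cif_unique; rewrite ?cifT //.
by have := cifF (~` a)%O r s; rewrite complK.
Qed.

Lemma cle_min r s : exists a, cif a r s <=c r /\ cif a r s <=c s.
Proof. by have [a [h]] := cle_total r s; rewrite cif_compl => k; exists a. Qed.

Lemma cifN a r s : - cif a r s = cif a (- r) (- s).
Proof. by rewrite -csumN; congr csum; apply/funext => -[]. Qed.

Lemma cifD a r r' s s' : cif a r s + cif a r' s' = cif a (r + r') (s + s').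
Proof. by rewrite -csumD; congr csum; apply/funext => -[]. Qed.

Lemma cpart r : exists a, (0 : R) <=c cif a r 0 /\ (0 : R) <=c cif a 0 (- r).
Proof.
have [a [h1 h2]] := cle_min 0 r; exists a; split.
  move/cle_sub0: h2; rewrite -[X in X - _](cif_id a) cifN cifD.
  by rewrite oppr0 addr0 subrr.
move/cle_sub0: h1; rewrite -[X in X - _](cif_id a) cifN cifD.
by rewrite oppr0 addr0 add0r.
Qed.

Lemma csupE (S : set R) s : csupremums S s -> csup S = s.
Proof.
move=> [us ls]; rewrite /csup; case: xgetP => [x _ [ux lx]|/(_ s)].
  by apply: cle_anti; [exact: lx|exact: ls].
by case.
Qed.

Lemma csupP (S : set R) : csupremums S !=set0 -> csupremums S (csup S).
Proof. by move=> [s h]; rewrite (csupE h). Qed.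

Lemma cabsE r a : (0 : R) <=c cif a r 0 -> (0 : R) <=c cif a 0 (- r) ->
  csupremums [set r; - r] (cif a r (- r)).
Proof.
move=> p0 q0; have nr x : cif a r (- r) - x = cif a (r - x) (- r - x).
  by rewrite -[in LHS](cif_id a x) cifN cifD.
split=> [_ [->|->]|u uu].
- apply/cle_sub0; rewrite nr subrr.
  by rewrite (_ : cif _ _ _ = cif a 0 (- r) + cif a 0 (- r));
    [rewrite -[X in X <=c _]addr0; exact: cleD|rewrite cifD addr0].
- apply/cle_sub0; rewrite nr subrr opprK.
  by rewrite (_ : cif _ _ _ = cif a r 0 + cif a r 0);
    [rewrite -[X in X <=c _]addr0; exact: cleD|rewrite cifD addr0].
rewrite -(cif_id a u); apply: cif_le; apply: uu; [by left|by right].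
Qed.

Lemma cabsP r : csupremums [set r; - r] (cabs r).
Proof. by have [a [p q]] := cpart r; apply: csupP; eexists; exact: cabsE p q. Qed.

Lemma cabs_ge0 r : (0 : R) <=c cabs r.
Proof.
have [a [p q]] := cpart r; rewrite /cabs (csupE (cabsE p q)).
have -> : cif a r (- r) = cif a r 0 + cif a 0 (- r).
  by rewrite cifD addr0 add0r.
by rewrite -[X in X <=c _]addr0; exact: cleD.
Qed.

Lemma cle_abs r : r <=c cabs r.
Proof. by apply: (cabsP r).1; left. Qed.

Lemma ger0_cabs r : (0 : R) <=c r -> cabs r = r.
Proof.
move=> r0; apply: csupE; split=> [_ [->|->]|u uu].
- exact: cle_refl.
- by apply/cle_sub0; rewrite opprK -[X in X <=c _]addr0; exact: cleD.
- by apply: uu; left.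
Qed.

Lemma cabs0 : cabs (0 : R) = 0.
Proof. by apply: ger0_cabs; exact: cle_refl. Qed.

Lemma csqr_ge0 r : (0 : R) <=c r * r.
Proof.
have [a [p q]] := cpart r.
have -> : r * r = cif a r 0 * cif a r 0 + cif a 0 (- r) * cif a 0 (- r).
  by rewrite !cifM cifD !mul0r mulrNN addr0 add0r cif_id.
by rewrite -[X in X <=c _]addr0; apply: cleD; exact: cle_mul.
Qed.

Lemma cle01 : (0 : R) <=c 1.
Proof. by rewrite -[1]mulr1; exact: csqr_ge0. Qed.

Lemma crestr1_neq0 a : a <> \bot -> restr (1 : R) a <> restr (0 : R) a.
Proof.
move=> a0 e; have [iota [[st inj] [i1 iD _ _]]] := @cr_rat _ _ R.
have c0 : crat_add (crat_const 0) (crat_const 0) = crat_const 0 :> crat A.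
  by rewrite /crat_add cstep_map2_const addr0.
have i0 : iota (crat_const 0) = 0.
  by apply: (addrI (iota (crat_const 0))); rewrite -iD c0 addr0.
have : cif a (crat_const 1) (crat_const 0) = crat_const 0 :> crat A.
  apply: inj; rewrite stable_fun_cif // i1 i0.
  by rewrite (cif_congr (x' := 0) (y' := 0)) // cif_id.
move=> /(congr1 (fun z => restr z a)); rewrite cifT.
move=> /cstep_restrP /(_ 1); rewrite !cstep_constE.
by rewrite asboolT // asboolF // meetx1 meetx0.
Qed.

Lemma clt01 : clt (0 : R) 1.
Proof. by split=> [|a /crestr1_neq0 h]; [exact: cle01|exact/nesym]. Qed.

Lemma cnnegE : cnneg R = [set r : R | (0 : R) <=c r].
Proof.
apply: smallest_id; split=> [|I a pa x x0]; first by exists 0; exact: cle_refl.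
by have := csum_le pa x0; rewrite csum_cst.
Qed.

Lemma csum_clt0 I (a : I -> A) (pa : is_partition \top a) (x : I -> R) :
  (forall i, clt 0 (x i)) -> clt 0 (csum pa x).
Proof.
move=> x0; split=> [|b b0 e].
  by rewrite -[X in X <=c _](csum_cst pa); apply: csum_le => i; case: (x0 i).
have [i bi] := partition_meet_neq0 pa (introN eqP b0).
case: (x0 i) => _ /(_ _ (elimN eqP bi)); apply.
rewrite (restr_le (leIl _ _) e).
exact: (restr_le (leIr _ _) (csumP pa x i)).
Qed.

Lemma cposE : cpos R = [set r : R | clt 0 r].
Proof.
apply: smallest_id; split=> [|I a pa x x0]; first by exists 1; exact: clt01.
exact: csum_clt0.
Qed.

Lemma clt0_inv r : clt 0 r -> exists2 s, r * s = 1 & (0 : R) <=c s.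
Proof.
move=> [r0 rn]; have [|s rs] := @cr_inv _ _ R r; first by move=> a /rn /nesym.
exists s => //; have -> : s = r * (s * s) by rewrite mulrA rs mul1r.
by apply: cle_mul => //; exact: csqr_ge0.
Qed.

Lemma clt0D r s : clt 0 r -> (0 : R) <=c s -> clt 0 (r + s).
Proof.
move=> [r0 rn] s0; split=> [|a a0 e].
  by rewrite -[X in X <=c _]addr0; exact: cleD.
apply: (rn a a0); have c0 : cif a (r + s) 0 = 0.
  by rewrite (cif_congr (x' := 0) (y' := 0)) // cif_id.
have ge0 t : (0 : R) <=c t -> (0 : R) <=c cif a t 0.
  move=> t0; have := cif_le a t0 (cle_refl 0).
  by rewrite cif_id.
have re : cif a r 0 = 0.
  apply: cle_anti (ge0 _ r0).
  have := cleD (cle_refl (cif a r 0)) (ge0 _ s0).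
  by rewrite addr0 cifD addr0 c0.
by rewrite -[in RHS](cifT a r 0) re.
Qed.

Lemma clt0M r s : clt 0 r -> clt 0 s -> clt 0 (r * s).
Proof.
move=> r0 s0; have [r' rr' r'0] := clt0_inv r0; case: (r0) => r00 rn.
case: (s0) => s00 sn; split=> [|a a0 e]; first exact: cle_mul.
apply: (sn a a0); have c0 : cif a (r * s) 0 = 0.
  by rewrite (cif_congr (x' := 0) (y' := 0)) // cif_id.
have se : cif a s 0 = 0.
  have -> : cif a s 0 = r' * cif a (r * s) 0.
    by rewrite -(cif_id a r') cifM mulr0 mulrA (mulrC r') rr' mul1r.
  by rewrite c0 mulr0.
by rewrite -[in RHS](cifT a s 0) se.
Qed.

Lemma cinv_clt0 r s : clt 0 r -> r * s = 1 -> (0 : R) <=c s -> clt 0 s.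
Proof.
move=> r0 rs s0; split=> // a a0 e; apply: (crestr1_neq0 a0).
have c0 : cif a s 0 = 0.
  by rewrite (cif_congr (x' := 0) (y' := 0)) // cif_id.
have e1 : cif a (1 : R) 0 = 0.
  by rewrite -rs -[X in cif _ _ X](mulr0 r) -cifM cif_id c0 mulr0.
by rewrite -[in LHS](cifT a 1 0) e1.
Qed.

Lemma cle_eps r : (forall e, clt 0 e -> r <=c e) -> r <=c 0.
Proof.
have lt2 : clt (0 : R) (1 + 1) by apply: clt0D clt01 cle01.
have [h h1 h0] := clt0_inv lt2; have hp := cinv_clt0 lt2 h1 h0.
have he e : e * h + e * h = e.
  by rewrite -mulrDr -[h]mul1r -mulrDl h1 mulr1.
pose S := [set s : R | forall e, clt 0 e -> s <=c e].
have S2 s : S s -> S (s + s).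
  move=> Ss e e0; rewrite -(he e).
  by apply: cleD; apply: Ss; exact: clt0M.
have [||m [um lm]] := @cr_dedekind _ _ R S.
- split=> [|I a pa x Sx e e0]; first by exists 0 => e [].
  by rewrite -(csum_cst pa e); apply: csum_le => i; exact: Sx.
- by exists 1 => s; apply; exact: clt01.
move=> Sr; apply: cle_trans (um _ Sr) _.
have: m <=c m * h.
  apply: lm => s /S2 /um; rewrite -[s in X in _ -> X]he -mulrDl => k.
  exact: cle_pmulr.
move=> /(cle_add (- (m * h))); rewrite subrr -{1}(he m) addrK => mh.
by rewrite -(he m) -[X in _ <=c X]addr0; exact: cleD.
Qed.

End CondRealTheory.

Section CondNormedTheory.
Context {d : Order.disp_t} {A : completeBAType d} {R : condRealType A}.
Context {E : condNormedType R}.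
Implicit Types (x y : E) (a b : A) (r : R).

Lemma cnorm_ge0 x : (0 : R) <=c cnorm x.
Proof. by have := cnorm_nneg x; rewrite cnnegE. Qed.

Lemma cnorm0 : cnorm (0 : E) = 0.
Proof. by rewrite -(scale0r (0 : E)) cnormZ cabs0 mul0r. Qed.

Lemma csumZ I (a : I -> A) (pa : is_partition \top a) (r : I -> R) (x : I -> E) :
  csum pa (fun i => r i *: x i) = csum pa r *: csum pa x.
Proof.
have := @cscale_stable _ _ R E I a pa (fun i => (r i, x i)).
by rewrite csum_pair.
Qed.

Lemma csum_norm I (a : I -> A) (pa : is_partition \top a) (x : I -> E) :
  csum pa (fun i => cnorm (x i)) = cnorm (csum pa x).
Proof. by rewrite cnorm_stable. Qed.

End CondNormedTheory.

Section CondLinear.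
Context {d : Order.disp_t} {A : completeBAType d} {R : condRealType A}.
Context (E F : condNormedType R).

(* Continuity for the conditional topologies of the norms; for linear maps it
   is equivalent to boundedness, see ccontinuousP. *)
Definition ccontinuous (f : E -> F) : Prop :=
  forall (x : E) (e : R), cpos R e -> exists2 dl : R, cpos R dl &
    forall y : E, cnorm (y - x) <=c dl -> cnorm (f y - f x) <=c e.

Record clinear : Type := CLinear {
  clinear_fun :> E -> F;
  clinear_stable : stable_fun clinear_fun;
  clinear_linear : linear clinear_fun;
  clinear_continuous : ccontinuous clinear_fun
}.

Lemma clinear0 (f : E -> F) : linear f -> f 0 = 0.
Proof.
move=> lf; have := lf 1 0 0; rewrite scaler0 addr0 scale1r => h.
by apply: (addrI (f 0)); rewrite -h addr0.
Qed.

Lemma clinearZ (f : E -> F) r x : linear f -> f (r *: x) = r *: f x.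
Proof. by move=> lf; have := lf r x 0; rewrite !addr0 (clinear0 lf) addr0. Qed.

Lemma clinearB (f : E -> F) x y : linear f -> f (x - y) = f x - f y.
Proof.
by move=> lf; have := lf (-1) y x; rewrite !scaleN1r ![- _ + _]addrC.
Qed.

Lemma ccontinuousP (f : E -> F) : linear f ->
  ccontinuous f <-> exists r : R, forall x, cnorm (f x) <=c r * cnorm x.
Proof.
move=> lf; split=> [cf|[r fr] x e].
  have [|dl] := cf 0 1; first by rewrite cposE; exact: clt01.
  rewrite cposE => dl0 fd; have [s ds s0] := clt0_inv dl0.
  exists s => x.
  suff h : cnorm (f x) * dl <=c cnorm x.
    have := cle_pmul s0 h; rewrite (mulrC (cnorm _)) mulrA (mulrC s) ds mul1r.
    by [].
  have {}fd y : cnorm y <=c dl -> cnorm (f y) <=c 1.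
    by move=> yd; have := fd y; rewrite (clinear0 lf) !subr0; apply.
  suff k : cnorm (f x) * dl - cnorm x <=c 0.
    by have := cle_add (cnorm x) k; rewrite subrK add0r.
  apply: cle_eps => e e0.
  have ne0 : clt 0 (e + cnorm x) by apply: clt0D => //; exact: cnorm_ge0.
  have [t et t0] := clt0_inv ne0.
  have dt0 : (0 : R) <=c dl * t by apply: cle_mul => //; case: dl0.
  have /fd : cnorm ((dl * t) *: x) <=c dl.
    rewrite cnormZ ger0_cabs // -[X in _ <=c X]mulr1 -mulrA.
    apply: cle_pmul; first by case: dl0.
    rewrite -et mulrC; apply: cle_pmulr => //.
    by rewrite -[X in X <=c _]add0r; apply: cleD; [case: e0|exact: cle_refl].
  rewrite (clinearZ _ _ lf) cnormZ ger0_cabs // => /(cle_pmul ne0.1).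
  rewrite mulr1 !mulrA (mulrC _ dl) -(mulrA dl) et mulr1 => /(cle_add (- cnorm x)).
  by rewrite addrK mulrC.
rewrite cposE => e0; pose m := cabs r + 1.
have m0 : clt 0 m by rewrite /m addrC; apply: clt0D clt01 (cabs_ge0 r).
have [s ms s0] := clt0_inv m0; have sp := cinv_clt0 m0 ms s0.
exists (s * e) => [|y xy]; first exact: clt0M.
rewrite -(clinearB _ _ lf); apply: cle_trans (fr _) _.
apply: (cle_trans (s := m * cnorm (y - x))).
  apply: cle_pmulr; first exact: cnorm_ge0.
  apply: cle_trans (cle_abs r) _; rewrite -[X in X <=c _]addr0.
  by apply: cleD; [exact: cle_refl|exact: cle01].
by have := cle_pmul m0.1 xy; rewrite mulrA ms mul1r.
Qed.

Let clinear_restr (T : clinear) (a : A) : A * (E -> cobj F) :=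
  (a, fun x => restr (T x) a).

Let clinear_restr_inj S T a b : clinear_restr S a = clinear_restr T b -> a = b.
Proof. by case. Qed.

Let clinear_restr_le S T a b : (a <= b)%O ->
  clinear_restr S b = clinear_restr T b ->
  clinear_restr S a = clinear_restr T a.
Proof.
move=> ab [h]; congr pair; apply/funext => x.
exact: (restr_le ab (congr1 (@^~ x) h)).
Qed.

Lemma clinear_eq (S T : clinear) : (forall x, S x = T x) -> S = T.
Proof.
case: S T => [f sf lf cf] [g sg lg cg] /= /funext fg.
case: _ / fg in sg lg cg *.
by congr CLinear; exact: Prop_irrelevance.
Qed.

Section Glue.
Context (I : Type) (a : I -> A) (pa : is_partition \top a) (T : I -> clinear).

Let glue (x : E) : F := csum pa (fun i => T i x).

Let glue_stable : stable_fun glue.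
Proof.
move=> J b pb x; apply: (restr_eq pa) => i; rewrite csumP clinear_stable.
by apply: csum_restr => j; rewrite /= csumP.
Qed.

Let glue_linear : linear glue.
Proof.
move=> r x y; rewrite /glue -[in RHS](csum_cst pa r) -csumZ -csumD.
by congr csum; apply/funext => i; rewrite clinear_linear.
Qed.

Let glue_continuous : ccontinuous glue.
Proof.
apply/(ccontinuousP glue_linear).
have /choice[r rT] i : exists r : R, forall x, cnorm (T i x) <=c r * cnorm x.
  by apply/ccontinuousP; [exact: clinear_linear|exact: clinear_continuous].
exists (csum pa r) => x; rewrite -csum_norm -[X in _ * X](csum_cst pa) -csumM.
by apply: csum_le => i; exact: rT.
Qed.

Definition clinear_glue : clinear :=
  CLinear glue_stable glue_linear glue_continuous.

End Glue.

Let clinear_glueP (I : Type) (a : I -> A) (T : I -> clinear) :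
  is_partition \top a ->
  exists! S, forall i, clinear_restr S (a i) = clinear_restr (T i) (a i).
Proof.
move=> pa; exists (clinear_glue pa T); split=> [i|S ST].
  by congr pair; apply/funext => x; rewrite /= csumP.
apply: clinear_eq => x; apply: (restr_eq pa) => i; rewrite /= csumP.
by have [/(congr1 (@^~ x)) /=] := ST i.
Qed.

Let clinear_zero : clinear.
Proof.
exists (fun=> 0) => [I a pa x|r x y|x e e0].
- by apply: csum_unique.
- by rewrite scaler0 addr0.
exists 1 => [|y _]; first by rewrite cposE; exact: clt01.
by rewrite subrr cnorm0; move: e0; rewrite cposE => -[].
Qed.

HB.instance Definition _ := isCondSet.Build d A clinear
  clinear_restr_inj clinear_restr_le clinear_glueP (inhabits clinear_zero).

Lemma clinear_restrP (S T : clinear) a :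
  restr S a = restr T a <-> forall x, restr (S x) a = restr (T x) a.
Proof.
split=> [[h] x|h]; first exact: (congr1 (@^~ x) h).
by congr pair; apply/funext.
Qed.

(* [ || T x || : || x || <= 1 ] *)
Definition copnorm_set (T : clinear) : set R :=
  stable_hull [set cnorm (T x) | x in [set x : E | cnorm x <=c (1 : R)]].

Definition copnorm (T : clinear) : R := csup (copnorm_set T).

Lemma copnormP (T : clinear) : csupremums (copnorm_set T) (copnorm T).
Proof.
apply: csupP; apply: cr_dedekind.
  apply: stable_hullP; exists (cnorm (T 0)); exists 0 => //=.
  by rewrite cnorm0; exact: cle01.
have /(ccontinuousP (@clinear_linear T))[r Tr] := @clinear_continuous T.
exists (cabs r) => s hs; apply: (hs [set t | t <=c cabs r]); split.
  split=> [|I a pa x xr]; first by exists 0; exact: cabs_ge0.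
  by have := csum_le pa xr; rewrite csum_cst.
move=> _ [x x1 <-] /=; apply: cle_trans (Tr x) _.
apply: (cle_trans (s := cabs r * cnorm x)).
  by apply: cle_pmulr; [exact: cnorm_ge0|exact: cle_abs].
by have := cle_pmul (cabs_ge0 r) x1; rewrite mulr1.
Qed.

End CondLinear.

(* Main.v *)
Require Import Defs.
From mathcomp Require Import all_boot all_order all_algebra.
From mathcomp Require Import boolp classical_sets.

Set Implicit Arguments.
Unset Strict Implicit.
Unset Printing Implicit Defensive.

Import Order.TTheory Order.CTheory GRing.Theory.

(** The classical gliding hump argument works once every case distinction is
    made locally, on a piece of a partition of the top of the algebra.

    Localization.  A property of elements a of the algebra that is inherited by
    gluings of partitions, and that holds on some nonzero part of every nonzero
    element, holds on the top ([partition_dense_top]).  Suppose that the values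
    T(x), with T in S and |x| at most 1, have no common bound.  Being bounded on
    a glues, so it fails densely: below some nonzero c there is no nonzero
    element on which the values are bounded.  Then every real t is exceeded on a
    nonzero part of every nonzero piece of c, and gluing T and x over these
    parts, which is where stability of S enters, gives one T in S and one x with
    t at most |T(x)| on all of c ([nowhere_bounded]).

    Gliding hump.  Let a ball of centre x and radius rho and a real t be given.
    Take T in S and z with |z| at most rho/2 and |T(z)| at least t + 1 on c.
    Since 2 T(z) = T(x + z) - T(x - z), choosing the sign of z piecewise gives a
    point x' at distance |z| from x with |T(x')| at least |T(z)|
    ([translate_norm_ge]), and by continuity |T| is at least t on c throughout a
    small ball around x' inside the given one ([subball_norm_ge]).

    Completeness.  Iterating with t = n + 1 and radii that are at least halved
    at each step gives nested balls, which have a common point y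
    ([nested_balls]).  The pointwise bound r of S at y then dominates every
    positive integer on c; by the Archimedean property ([le_on_archi]) this
    forces c to be zero.

    The balls are indexed by ordinary natural numbers, so ordinary dependent
    choice produces them; the sequence of centres is extended to the conditional
    natural numbers by gluing ([cseq]) in order to apply completeness. *)

Local Open Scope ring_scope.
Local Open Scope cond_scope.

(** * Localization in a complete Boolean algebra *)

(** Exhaustion: Zorn's lemma gives a maximal disjoint subset of D.  A nonzero
    complement of its supremum would contain a further element of D, so the
    subset is a partition of the top, over which D glues. *)
Lemma partition_dense_top (d : Order.disp_t) (A : completeBAType d)
    (D : set A) :
  (forall (I : Type) (a : I -> A), is_partition \top%O a ->
     (forall i, D (a i)) -> D \top%O) ->
  (forall b : A, b <> \bot%O ->
     exists2 a : A, D a & a <> \bot%O /\ (a <= b)%O) ->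
  D \top%O.
Proof.
move=> glue dense.
pose disj (M : set A) := (forall a, M a -> D a) /\
  forall a b, M a -> M b -> a <> b -> (a `&` b)%O = \bot%O.
have [|M [[MD Mdis] Mmax]] := @Zorn_bigcup A disj.
  move=> C Cd Ctot; split=> [a [M CM Ma]|a b [M CM Ma] [N CN Nb]].
    by have [+ _] := Cd _ CM; apply.
  have [MN|NM] := Ctot _ _ CM CN.
    by apply: (Cd _ CN).2 => //; exact: MN.
  by apply: (Cd _ CM).2 => //; exact: NM.
apply: (glue {a | M a} (@proj1_sig _ _)) => [|[a Ma]]; last exact: MD.
split=> [[a Ma] [b Mb] /= ab|].
  apply: Mdis => // e; apply: ab; case: _ / e Mb => Mb; congr exist.
  exact: Prop_irrelevance.
have rgM : range (@proj1_sig A M) = M.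
  by apply/seteqP; split=> [_ [[a Ma] _ <-]//|a Ma]; exists (exist _ a Ma).
rewrite rgM; have sM := supremumP M; set s := supremum _ M in sM.
suff <- : s = \top%O by [].
apply: contrapT => sn.
have [|a Da [a0 as']] := dense (~` s)%O.
  by move=> e; apply: sn; rewrite -(complK s) e compl0.
have disa b : M b -> (a `&` b)%O = \bot%O.
  move=> /sM.1 bs; apply/eqP; rewrite -lex0 -(meetCx s); exact: leI2.
have nMa : ~ M a.
  by move=> /disa; rewrite meetxx.
apply: (Mmax (M `|` [set a])%classic).
  split=> [|/(_ a (or_intror erefl))//]; exact: subsetUl.
split=> [b [/MD//|-> //]|b e [Mb|->] [Me|->]] ne //; first exact: Mdis.
- by rewrite meetC disa.
- by rewrite disa.
Qed.

(** * Inequalities between conditional reals on a part of the algebra *)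

Section LocalOrder.
Context {d : Order.disp_t} {A : completeBAType d} {R : condRealType A}.
Implicit Types (r s t : R) (a b : A).

(** This is r | a <= s | a.  Replacing both sides by 0 off a turns it into an
    inequality in R, so that sums, products and transitivity of the order carry
    over from R. *)
Definition le_on a r s := cif a r 0 <=c cif a s 0.

(** All elements coincide on the bottom, whose complement is the top. *)
Lemma restr_bot (E : condSetType A) (x y : E) :
  restr x \bot%O = restr y \bot%O.
Proof.
rewrite -(cifT \bot%O x y); apply: (restr_le (le0x (~` \bot)%O)).
exact: cifF.
Qed.

Lemma le_on_restr a r r' s s' : restr r a = restr r' a ->
  restr s a = restr s' a -> le_on a r s -> le_on a r' s'.
Proof.
move=> rr ss; rewrite /le_on.
by rewrite (cif_congr (y' := 0) rr)// (cif_congr (x := s) (y' := 0) ss).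
Qed.

Lemma le_on_bot r s : le_on \bot%O r s.
Proof.
rewrite /le_on (cif_congr (x' := s) (y' := 0)) //; first exact: cle_refl.
exact: restr_bot.
Qed.

Lemma cle_on a r s : r <=c s -> le_on a r s.
Proof. by move=> rs; apply: cif_le => //; exact: cle_refl. Qed.

Lemma le_on_trans a s r t : le_on a r s -> le_on a s t -> le_on a r t.
Proof. exact: cle_trans. Qed.

Lemma le_on_sub a b r s : (a <= b)%O -> le_on b r s -> le_on a r s.
Proof.
move=> ab /(cle_on a); apply: le_on_restr.
- exact: (restr_le ab (cifT _ _ _)).
- exact: (restr_le ab (cifT _ _ _)).
Qed.

Lemma le_on_glue I (a : I -> A) (pa : is_partition \top%O a) r s :
  (forall i, le_on (a i) r s) -> r <=c s.
Proof.
have E t : t = csum pa (fun i => cif (a i) t 0).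
  by apply: csum_unique => i; rewrite cifT.
by move=> rs; rewrite (E r) (E s); exact: csum_le.
Qed.

(** The pieces outside b are harmless because both truncations vanish there. *)
Lemma le_on_meet I (a : I -> A) (pa : is_partition \top%O a) b r s :
  (forall i, le_on (b `&` a i)%O r s) -> le_on b r s.
Proof.
move=> rs.
have pb := partition_dep (partition_compl b) (fun=> pa).
apply: (le_on_glue pb) => -[[] i] /=.
  by apply: le_on_restr (rs i); apply/esym/(restr_le (leIl _ _))/cifT.
have out t : restr 0 (~` b `&` a i)%O = restr (cif b t 0) (~` b `&` a i)%O.
  by apply/esym/(restr_le (leIl _ _))/cifF.
exact: le_on_restr (out r) (out s) (cle_on _ (cle_refl 0)).
Qed.

Lemma le_on_top r s : le_on \top%O r s -> r <=c s.
Proof. by move=> rs; apply: (le_on_glue partition_unit). Qed.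

Lemma le_on_total r s : exists a, le_on a r s /\ le_on (~` a)%O s r.
Proof.
have [a [rs sr]] := cle_total r s; exists a; split.
  by apply: le_on_restr (cle_on a rs) => //; exact: cifT.
by apply: le_on_restr (cle_on _ sr) => //; exact: cifT.
Qed.

Lemma le_onD a r r' s s' :
  le_on a r s -> le_on a r' s' -> le_on a (r + r') (s + s').
Proof.
by move=> rs rs'; rewrite /le_on -(addr0 0) -!cifD; exact: cleD.
Qed.

Lemma cif0M a r s : cif a (r * s) 0 = r * cif a s 0.
Proof. by rewrite -[r in RHS](cif_id a) cifM mulr0. Qed.

Lemma le_onM a t r s : 0 <=c t -> le_on a r s -> le_on a (t * r) (t * s).
Proof. by move=> t0 rs; rewrite /le_on !cif0M; exact: cle_pmul. Qed.

(** The negation of a conditional inequality only yields the reverse inequality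
    on some nonzero part; this is the step at which each argument by
    contradiction has to be localized. *)
Lemma not_le_on a r s : ~ le_on a r s ->
  exists2 b, le_on b s r & b <> \bot%O /\ (b <= a)%O.
Proof.
move=> nrs; have [b [rs sr]] := le_on_total r s.
exists (a `&` ~` b)%O; first exact: le_on_sub (leIr _ _) sr.
split=> [e|]; last exact: leIl.
apply: nrs; apply: le_on_sub rs; rewrite -(complK b).
by rewrite -Order.CTBDistrLatticeTheory.disj_leC e.
Qed.

Lemma cubound_hull (S : set R) u : cubound (stable_hull S) u <-> cubound S u.
Proof.
split=> [Su r Sr|Su r hr]; first by apply: Su => T [_]; apply.
apply: (hr [set t | t <=c u]%classic); split; last exact: Su.
split=> [|I a pa x xu]; first by exists u; exact: cle_refl.
by have := csum_le pa xu; rewrite csum_cst.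
Qed.

(** The Archimedean property, from Dedekind completeness: the supremum m of the
    multiples of r is also bounded by m - r, since r plus a multiple is again a
    multiple. *)
Lemma cle_archi r s : (forall n, r *+ n.+1 <=c s) -> r <=c 0.
Proof.
move=> rn; pose N := stable_hull [set r *+ n.+1 | n in [set: nat]]%classic.
have sub u : cubound N u <-> forall n, r *+ n.+1 <=c u.
  apply: (iff_trans (cubound_hull _ _)); split=> [Nu n|nu _ [n _ <-]//].
  by apply: Nu; exists n.
have [||m [um lm]] := @cr_dedekind _ _ R N.
- by apply: stable_hullP; exists (r *+ 1); exists 0%N.
- by exists s; apply/sub.
move/sub: um => um; have /lm : cubound N (m - r).
  apply/sub => n; have := cle_add (- r) (um n.+1).
  by rewrite mulrSr addrK.
by move/(cle_add (- m)); rewrite addrAC subrr => ?; apply/cle_sub0.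
Qed.

Lemma cle_mulrn n r s : r <=c s -> r *+ n <=c s *+ n.
Proof.
move=> rs; elim: n => [|n IH]; first exact: cle_refl.
by rewrite !mulrS; exact: cleD.
Qed.

Lemma chalf r : clt 0 r -> exists2 e, clt 0 e & e + e = r.
Proof.
move=> r0; have lt2 : clt (0 : R) (1 + 1) by apply: clt0D clt01 cle01.
have [h h1 h0] := clt0_inv lt2; have hp := cinv_clt0 lt2 h1 h0.
exists (r * h); first exact: clt0M.
by rewrite -mulrDr -[h]mul1r -mulrDl h1 mulr1.
Qed.

Lemma le_on_mulrn a n r s : le_on a r s -> le_on a (r *+ n) (s *+ n).
Proof.
move=> rs; elim: n => [|n IH]; first exact/cle_on/cle_refl.
by rewrite !mulrS; exact: le_onD.
Qed.

Lemma le_on_archi a r s :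
  (forall n, le_on a (r *+ n.+1) s) -> le_on a r 0.
Proof.
move=> rs; rewrite /le_on cif_id; apply: (@cle_archi _ (cif a s 0)) => n.
suff <- : cif a (r *+ n.+1) 0 = cif a r 0 *+ n.+1 by exact: rs.
by elim: n.+1 => [|m IH]; rewrite ?cif_id// !mulrS -IH cifD addr0.
Qed.

Lemma le_on_pos_bot a r : clt 0 r -> le_on a r 0 -> a = \bot%O.
Proof.
move=> [r0 rn]; rewrite /le_on cif_id => ar0; apply: contrapT => /rn; apply.
suff e : cif a r 0 = 0 by rewrite -(cifT a r 0) e.
by apply: cle_anti => //; have := cle_on a r0; rewrite /le_on cif_id.
Qed.

Lemma cmin_pos r s : clt 0 r -> clt 0 s ->
  exists2 t, clt 0 t & t <=c r /\ t <=c s.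
Proof.
move=> r0 s0; have [a rs] := cle_min r s; exists (cif a r s) => //.
by apply: csum_clt0 => -[].
Qed.

End LocalOrder.

(** * Nested balls in a conditional Banach space *)

Section Balls.
Context {d : Order.disp_t} {A : completeBAType d} {R : condRealType A}.
Implicit Types (r s t : R) (a b : A).

Section Norm.
Context {E : condNormedType R}.
Implicit Types (x y z : E).

Lemma cabsN r : cabs (- r) = cabs r.
Proof. by congr csup; rewrite opprK classical_sets.setUC. Qed.

Lemma cnormN x : cnorm (- x) = cnorm x.
Proof. by rewrite -scaleN1r cnormZ cabsN ger0_cabs ?mul1r //; exact: cle01. Qed.

Lemma cdistC x y : cnorm (x - y) = cnorm (y - x).
Proof. by rewrite -cnormN opprB. Qed.

Lemma cdistD z x y : cnorm (x - y) <=c cnorm (x - z) + cnorm (y - z).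
Proof.
by rewrite (cdistC y) -[x - y](subrKA z); exact: cnormD.
Qed.

(** The distance is a stable function of the pair of points, hence local. *)
Lemma restr_dist a x x' y y' : restr x a = restr x' a ->
  restr y a = restr y' a -> restr (cnorm (x - y)) a = restr (cnorm (x' - y')) a.
Proof.
move=> xx yy.
have sf : stable_fun (fun p : E * E => cnorm (p.1 - p.2)).
  by move=> I b pb p; rewrite csum_pair /= -csumN -csumD -csum_norm.
apply: (stable_fun_restr (x := (x, y)) (y := (x', y')) sf).
by rewrite /restr /= xx yy.
Qed.

End Norm.

(** The conditional sequence that extends an ordinary one: its value at the
    formal sum of the n_i on a_i is the gluing of the x(n_i) on a_i. *)
Definition cseq (E : condSetType A) (x : nat -> E) (n : cnat A) : E :=
  csum (cstep_partition n) (fun k => x (val k)).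

Lemma cseq_formal (E : condSetType A) (x : nat -> E) I (a : I -> A)
    (pa : is_partition \top%O a) (n : I -> posnat) i :
  restr (cseq x (formal_sum pa n)) (a i) = restr (x (val (n i))) (a i).
Proof.
have le_i : (a i <= formal_sum pa n (n i))%O.
  by have := formal_sumE pa n i (n i); rewrite asboolT // => /meet_idPl.
exact: (restr_le le_i (csumP (cstep_partition _) _ (n i))).
Qed.

Lemma cseq_stable (E : condSetType A) (x : nat -> E) : stable_fun (cseq x).
Proof.
move=> I a pa n.
apply: (restr_eq (partition_dep pa (fun i => cstep_partition (n i)))) => -[i k].
rewrite /= (restr_le (leIl _ _) (csumP pa _ i)) /=.
rewrite (restr_le (leIr _ _) (csumP (cstep_partition (n i)) _ k)).
have /cstep_restrP/(_ k) <- := csumP pa n i.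
exact: (restr_le (leIr _ _) (csumP (cstep_partition _) _ k)).
Qed.

(** Radii that halve become smaller than e conditionally: the index needed
    varies over the algebra, so N is glued from constants.  Where no index would
    do, e *+ n would stay below the first radius for all n. *)
Lemma cnull_cnat (rho : nat -> R) :
  (forall n, 0 <=c rho n) -> (forall n, rho n.+1 *+ 2 <=c rho n) ->
  forall e, clt 0 e ->
    exists N : cnat A, forall k, le_on (N k) (rho (val k)) e.
Proof.
move=> rho0 rhoS e e0.
pose D a := exists N : cnat A, forall k, le_on (a `&` N k)%O (rho (val k)) e.
suff [N NP] : D \top%O by exists N => k; have := NP k; rewrite meet1x.
apply: partition_dense_top => [I a pa /choice[N NP]|b b0].
  exists (csum pa N) => k; rewrite meet1x.
  apply: (le_on_meet pa) => i; rewrite meetC.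
  by have /cstep_restrP/(_ k) -> := csumP pa N i.
apply: contrapT => nD; apply: b0; apply: (le_on_pos_bot e0).
apply: (le_on_archi (s := rho 0%N)) => n.
have rhoD m : rho m.+1 <=c rho m.
  apply: cle_trans (rhoS m); rewrite mulr2n -[X in X <=c _]addr0.
  by apply: cleD => //; exact: cle_refl.
have rhoM m : rho m *+ m.+1 <=c rho 0%N.
  elim: m => [|m IH]; first exact: cle_refl.
  apply: cle_trans IH; rewrite -(add2n m) mulrnDr [rho m *+ _]mulrS.
  by apply: cleD => //; exact: cle_mulrn.
have rhon := cle_trans (cle_mulrn n.+1 (rhoD n)) (rhoM n).
apply: le_on_trans (cle_on b rhon); apply: le_on_mulrn.
apply: contrapT => /not_le_on[c ce [c0 cb]]; apply: nD; exists c => //.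
exists (cstep_const (exist _ n.+1 isT : posnat)) => k; rewrite cstep_constE.
case: asboolP => [<-|_]; first by rewrite meetx1.
by rewrite meetx0; exact: le_on_bot.
Qed.

(** The hypothesis on consecutive centres says that each ball contains the next,
    so the centres are Cauchy at the rate of the radii.  Both the Cauchy
    property of the extended sequence and the bound on its limit are checked on
    the common pieces of the conditional indices, where the sequence takes
    ordinary values. *)
Lemma nested_balls (E : condBanachType R) (x : nat -> E) (rho : nat -> R) :
  (forall n, 0 <=c rho n) -> (forall n, rho n.+1 *+ 2 <=c rho n) ->
  (forall n, cnorm (x n.+1 - x n) + rho n.+1 <=c rho n) ->
  exists y, forall n, cnorm (y - x n) <=c rho n.
Proof.
move=> rho0 rhoS xS.
have near m k : (k <= m)%N -> cnorm (x m - x k) <=c rho k.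
  move=> km; suff : cnorm (x m - x k) + rho m <=c rho k.
    apply: cle_trans; rewrite -[X in X <=c _]addr0.
    by apply: cleD => //; exact: cle_refl.
  rewrite -(subnK km); elim: (m - k)%N => [|i IH].
    by rewrite add0n subrr cnorm0 add0r; exact: cle_refl.
  apply: cle_trans IH; rewrite addSn; set j := (i + k)%N.
  apply: (cle_trans
    (s := cnorm (x j - x k) + (cnorm (x j.+1 - x j) + rho j.+1))).
    rewrite addrA; apply: cle_add; rewrite addrC -[x j.+1 - x k](subrKA (x j)).
    exact: cnormD.
  by apply: cleD => //; exact: cle_refl.
have small := cnull_cnat rho0 rhoS.
have [r|y xy] := cbanach_complete _ (cseq_stable x).
  rewrite cposE => r0; have [e e0 er] := chalf r0; have [N Ne] := small e e0.
  exists N => p q Np Nq; apply: (le_on_glue (partition_dep (cstep_partition N)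
    (fun=> partition_dep (cstep_partition p) (fun=> cstep_partition q)))).
  move=> [k [i j]] /=.
  have [->|ne0] := eqVneq (N k `&` (p i `&` q j))%O \bot%O.
    exact: le_on_bot.
  have ki : (val k <= val i)%N.
    apply/ltnW/Np; apply: contra ne0 => /eqP ki0.
    by rewrite meetA ki0 meet0x.
  have kj : (val k <= val j)%N.
    apply/ltnW/Nq; apply: contra ne0 => /eqP ki0.
    by rewrite meetCA ki0 meetx0.
  have : cnorm (x (val i) - x (val j)) <=c rho (val k) + rho (val k).
    by apply: cle_trans (cdistD (x (val k)) _ _) _; apply: cleD; exact: near.
  move=> /(cle_on (N k `&` (p i `&` q j))%O) dij.
  have dr : le_on (N k `&` (p i `&` q j))%O (cnorm (x (val i) - x (val j))) r.
    apply: le_on_trans dij _; rewrite -er; apply: le_on_sub (leIl _ _) _.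
    exact: le_onD.
  apply: le_on_restr dr => //; apply/esym/restr_dist.
    have le_i : (N k `&` (p i `&` q j) <= p i)%O by rewrite meetCA leIl.
    exact: (restr_le le_i (csumP (cstep_partition p) _ i)).
  have le_j : (N k `&` (p i `&` q j) <= q j)%O by rewrite meetA leIr.
  exact: (restr_le le_j (csumP (cstep_partition q) _ j)).
exists y => k.
suff : cnorm (y - x k) - rho k <=c 0.
  by move/(cle_add (rho k)); rewrite subrK add0r.
apply: cle_eps => e e0; have [|m my] := xy e; first by rewrite cposE.
(* Raising the index m to at least k puts the glued centres in the k-th ball. *)
have pos_max (j : posnat) : (0 < maxn (val j) k)%N.
  by rewrite leq_max (valP j).
pose p := formal_sum (cstep_partition m)
  (fun j => exist (fun n => 0 < n)%N _ (pos_max j) : posnat).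
have mp : cnat_le m p.
  move=> i j; have := formal_sumE (cstep_partition m)
    (fun j => exist (fun n => 0 < n)%N _ (pos_max j) : posnat) i j.
  rewrite -/p => ->; case: asboolP => [<- _|]; last by rewrite eqxx.
  exact: leq_maxl.
apply: (le_on_glue (cstep_partition m)) => j.
have := cle_on (m j) (my p mp).
pose z := x (maxn (val j) k).
move=> /(le_on_restr (r' := cnorm (z - y)) (s' := e)) h.
have {}h : le_on (m j) (cnorm (z - y)) e.
  apply: h => //; apply: restr_dist => //.
  exact: (cseq_formal x (cstep_partition m)).
apply: le_on_trans h; apply: cle_on.
have zk : cnorm (x k - z) <=c rho k.
  by rewrite cdistC; apply: near; exact: leq_maxr.
have := cle_trans (cdistD z y (x k)) (cleD (cle_refl _) zk).
by move/(cle_add (- rho k)); rewrite addrK (cdistC y z).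
Qed.

End Balls.

(** * Gliding humps *)

Section Humps.
Context {d : Order.disp_t} {A : completeBAType d} {R : condRealType A}.
Context {E F : condNormedType R}.
Implicit Types (S : set (clinear E F)) (T : clinear E F) (x y z : E) (c : A).

(** x' is x + z or x - z, on each piece whichever has the larger image; the
    larger image dominates half the norm of T(x + z) - T(x - z) = 2 T(z). *)
Lemma translate_norm_ge T x z : exists2 x',
  cnorm (x' - x) = cnorm z & cnorm (T z) <=c cnorm (T x').
Proof.
have lT := @clinear_linear _ _ _ _ _ T.
have [a [le_a ge_a]] := le_on_total (cnorm (T (x - z))) (cnorm (T (x + z))).
pose x' := cif a (x + z) (x - z).
have Tx'a : restr (cnorm (T (x + z))) a = restr (cnorm (T x')) a.
  apply/esym/(stable_fun_restr cnorm_stable).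
  by apply: (stable_fun_restr (clinear_stable T)); exact: cifT.
have Tx'c : restr (cnorm (T (x - z))) (~` a)%O = restr (cnorm (T x')) (~` a)%O.
  apply/esym/(stable_fun_restr cnorm_stable).
  by apply: (stable_fun_restr (clinear_stable T)); exact: cifF.
have ge_cases u : le_on a u (cnorm (T (x + z))) ->
    le_on (~` a)%O u (cnorm (T (x - z))) -> u <=c cnorm (T x').
  move=> ua uc; apply: (le_on_glue (partition_compl a)) => -[].
    exact: le_on_restr Tx'a ua.
  exact: le_on_restr Tx'c uc.
have le_p : cnorm (T (x + z)) <=c cnorm (T x').
  by apply: ge_cases => //; exact/cle_on/cle_refl.
have le_m : cnorm (T (x - z)) <=c cnorm (T x').
  by apply: ge_cases => //; exact/cle_on/cle_refl.
exists x'.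
  rewrite -[RHS](cif_id a); apply: cif_unique.
    rewrite (restr_dist (x' := x + z) (y' := x)) ?cifT //.
    by rewrite addrAC subrr add0r.
  rewrite (restr_dist (x' := x - z) (y' := x)) ?cifF //.
  by rewrite addrAC subrr add0r cnormN.
have two : cnorm (T z) + cnorm (T z) <=c cnorm (T x') + cnorm (T x').
  have -> : cnorm (T z) + cnorm (T z) = cnorm (T (x + z) - T (x - z)).
    rewrite -(clinearB _ _ lT) opprB [x + z + _]addrC addrA subrK.
    have -> : z + z = (1 + 1) *: z by rewrite scalerDl scale1r.
    rewrite (clinearZ _ _ lT) cnormZ ger0_cabs ?mulrDl ?mul1r //.
    by have [] := clt0D (@clt01 _ _ R) cle01.
  apply: cle_trans (cleD le_p le_m).
  by rewrite -(cnormN (T (x - z))); exact: cnormD.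
have [h h0 h1] := chalf (@clt01 _ _ R).
by have := cle_pmul h0.1 two; rewrite !mulrDr -!mulrDl h1 !mul1r.
Qed.

(** Half of rho is spent on moving the centre to a point where |T| is at least
    t + 1 on c, the other half on the new radius; the surplus 1 absorbs the
    variation of T over the new ball. *)
Lemma subball_norm_ge S c :
  (forall t, exists T x, [/\ S T, cnorm x <=c 1 & le_on c t (cnorm (T x))]) ->
  forall x rho t, clt 0 rho -> exists x' rho',
    [/\ clt 0 rho', rho' *+ 2 <=c rho, cnorm (x' - x) + rho' <=c rho &
      exists2 T, S T &
        forall z, cnorm (z - x') <=c rho' -> le_on c t (cnorm (T z))].
Proof.
move=> unb x rho t rho0; have [eta eta0 etaD] := chalf rho0.
have [inv etaV _] := clt0_inv eta0.
have [T [y [ST y1 Ty]]] := unb (inv * (t + 1)).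
have [x' xx' Tx'] := translate_norm_ge T x (eta *: y).
have [|dl] := @clinear_continuous _ _ _ _ _ T x' 1.
  by rewrite cposE; exact: clt01.
rewrite cposE => dl0 Tdl.
have [rho' rho'0 [le_dl le_eta]] := cmin_pos dl0 eta0.
exists x', rho'; split=> //.
- by rewrite mulr2n -etaD; exact: cleD.
- rewrite -etaD xx'; apply: cleD => //.
  rewrite cnormZ (ger0_cabs eta0.1) -[X in _ <=c X]mulr1.
  by apply: cle_pmul => //; exact: eta0.1.
exists T => // z zx'.
have Tz : cnorm (T x') <=c cnorm (T z) + 1.
  have := cnormD (T z) (T x' - T z); rewrite addrC subrK => /cle_trans; apply.
  apply: cleD; first exact: cle_refl.
  by rewrite cdistC; apply: Tdl; exact: cle_trans zx' le_dl.
have : le_on c (t + 1) (cnorm (T z) + 1).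
  apply: le_on_trans (cle_on c Tz); apply: le_on_trans (cle_on c Tx').
  rewrite (clinearZ _ _ (clinear_linear T)) cnormZ (ger0_cabs eta0.1).
  rewrite -[t + 1]mul1r -[X in X * _]etaV -mulrA.
  by apply: le_onM => //; exact: eta0.1.
move=> /le_onD/(_ (cle_on c (cle_refl (-1)))).
by rewrite !addrK.
Qed.

(** Failure of a bound on the top only gives one nonzero c without bounded
    nonzero parts.  There every bound t is violated densely, and gluing the
    witnesses over a partition of c makes a single pair violate it on all of
    c. *)
Lemma nowhere_bounded S : stable_set S ->
  ~ (exists s, forall T x, S T -> cnorm x <=c 1 -> cnorm (T x) <=c s) ->
  exists2 c, c <> \bot%O &
    forall t, exists T x, [/\ S T, cnorm x <=c 1 & le_on c t (cnorm (T x))].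
Proof.
move=> [[T0 ST0] Sglue] nb.
pose D a := exists s, forall T x, S T -> cnorm x <=c 1 ->
  le_on a (cnorm (T x)) s.
have [c [c0 nDc]] : exists c, c <> \bot%O /\
    forall a, a <> \bot%O -> (a <= c)%O -> ~ D a.
  apply: contrapT => nc; apply: nb.
  suff [s sP] : D \top%O by exists s => T x ST x1; exact/le_on_top/sP.
  apply: partition_dense_top => [I a pa /choice[s sP]|b b0].
    exists (csum pa s) => T x ST x1; apply/cle_on/(le_on_glue pa) => i.
    by apply: le_on_restr (sP i T x ST x1) => //; rewrite csumP.
  apply: contrapT => nb'; apply: nc; exists b; split=> // a a0 ab Da.
  by apply: nb'; exists a.
exists c => // t.
(* The intersection makes the requirement void on parts disjoint from c. *)
pose D' a := exists T x,
  [/\ S T, cnorm x <=c 1 & le_on (a `&` c)%O t (cnorm (T x))].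
suff [T [x]] : D' \top%O by rewrite meet1x => ?; exists T, x.
apply: partition_dense_top => [I a pa /choice[T /choice[x TxP]]|b b0].
  exists (csum pa T), (csum pa x); split.
  - by apply: Sglue => i; case: (TxP i).
  - rewrite -csum_norm -(csum_cst pa (1 : R)).
    by apply: csum_le => i; case: (TxP i).
  rewrite meet1x; apply: (le_on_meet pa) => i; rewrite meetC.
  case: (TxP i) => _ _; apply: le_on_restr => //.
  apply: (restr_le (leIl _ _)); apply: (stable_fun_restr cnorm_stable).
  have /clinear_restrP -> := csumP pa T i.
  by apply/esym/(stable_fun_restr (clinear_stable _)); exact: csumP.
have [bc|bc] := eqVneq (b `&` c)%O \bot%O.
  exists b; last by split.
  exists T0, 0; split=> //; first by rewrite cnorm0; exact: cle01.
  by rewrite bc; exact: le_on_bot.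
have := nDc _ (elimN eqP bc) (leIr _ _).
apply: contra_notP => nD'; exists t => T x ST x1.
apply: contrapT => /not_le_on[a ta [a0 abc]]; apply: nD'; exists a.
  by exists T, x; split=> //; exact: le_on_sub (leIl _ _) ta.
by split=> //; apply: le_trans abc _; exact: leIl.
Qed.

End Humps.

Theorem theorem2p2 (d : Order.disp_t) (A : completeBAType d)
    (R : condRealType A) (E : condBanachType R) (F : condNormedType R)
    (S : set (clinear E F)) (S_stable : stable_set S)
    (S_bounded : forall x : E, exists r : R,
       forall T : clinear E F, S T -> cnorm (T x) <=c r) :
  exists s : R, cpos R s /\ forall T : clinear E F, S T -> copnorm T <=c s.
Proof.
suff [s sP] : exists s, forall T x, S T -> cnorm x <=c 1 -> cnorm (T x) <=c s.
  exists (1 + cabs s); split.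
    by rewrite cposE; apply: clt0D clt01 (cabs_ge0 s).
  move=> T ST; apply: (copnormP T).2; apply/cubound_hull => _ [x x1 <-].
  apply: cle_trans (sP T x ST x1) _; apply: cle_trans (cle_abs s) _.
  by rewrite -[X in X <=c _]add0r; apply: cle_add; exact: cle01.
apply: contrapT => /(nowhere_bounded S_stable)[c c0 unb]; apply: c0.
have /choice[step stepP] : forall p : E * R * nat, exists q : E * R,
    clt 0 p.1.2 -> [/\ clt 0 q.2, q.2 *+ 2 <=c p.1.2,
      cnorm (q.1 - p.1.1) + q.2 <=c p.1.2 & exists2 T, S T &
      forall z, cnorm (z - q.1) <=c q.2 -> le_on c (1 *+ p.2.+1) (cnorm (T z))].
  move=> [[x rho] n] /=.
  have [rho0|] := pselect (clt 0 rho); last by exists (x, rho).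
  have [x' [rho' ?]] := subball_norm_ge unb x (1 *+ n.+1) rho0.
  by exists (x', rho').
(* From an arbitrary first ball, step n forces |T| to be at least n + 1 on c. *)
pose ball n := iteri n (fun i q => step (q, i)) (0, 1).
have ball0 n : clt 0 (ball n).2.
  elim: n => [|n IH]; first exact: clt01.
  by have [] := stepP (ball n, n) IH.
have ballP n := stepP (ball n, n) (ball0 n).
have [||| y yP] :=
    @nested_balls _ _ _ E (fun n => (ball n).1) (fun n => (ball n).2).
- by move=> n; case: (ball0 n).
- by move=> n; case: (ballP n).
- by move=> n; case: (ballP n).
have [r rP] := S_bounded y.
apply: (le_on_pos_bot clt01); apply: (le_on_archi (s := r)) => n.
have [_ _ _ [T ST Tn]] := ballP n.
by apply: le_on_trans (Tn y (yP n.+1)) _; apply: cle_on; exact: rP.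
Qed.
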